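(* Let $\mathfrak{B}$ be a tightly $\sigma$-filtered Boolean algebra, let $\mathcal{H}$ be a family of countable subsets of $\mathfrak{B}$ with $|\mathcal{H}|=\omega_2$, and let $P(x_1,\ldots,x_n)$ be a Boolean polynomial. Then either (1) there exists $\mathcal{H}_0\subseteq\mathcal{H}$ with $|\mathcal{H}_0|=\omega_2$ such that $P(a_1,\ldots,a_n)\neq0$ whenever $H_1,\ldots,H_n\in\mathcal{H}_0$ are pairwise different and $a_i\in H_i$ for each $i$; or (2) there exist $\mathcal{H}_1,\ldots,\mathcal{H}_n\subseteq\mathcal{H}$, each of cardinality $\omega_2$, such that for every $H_1\in\mathcal{H}_1,\ldots,H_n\in\mathcal{H}_n$ there exist $a_i\in H_i$ ($i=1,\ldots,n$) with $P(a_1,\ldots,a_n)=0$.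
   Context: For a subset $X$ of a Boolean algebra, $\langle X\rangle$ is the subalgebra generated by $X$. Two subalgebras $A,S$ of a Boolean algebra commute if whenever $a\in A$, $s\in S$ and $a\wedge s=0$, there exist $b_1,b_2\in A\cap S$ with $a\le b_1$, $s\le b_2$, $b_1\wedge b_2=0$. A square of inclusions $R\subseteq A\subseteq B$, $R\subseteq S\subseteq B$ is a push-out diagram if $\langle A\cup S\rangle=B$, $A\cap S=R$, and $A$ and $S$ commute. A Boolean algebra $\mathfrak{B}$ is tightly $\sigma$-filtered if there is an increasing chain of subalgebras $(B_\alpha)_{\alpha<\xi}$ indexed by an ordinal $\xi$ with: $B_0=\{0,1\}$; $\mathfrak{B}=\bigcup_{\alpha<\xi}B_\alpha$; $B_\alpha=\bigcup_{\beta<\alpha}B_\beta$ for limit $\alpha$; and for every $\alpha<\xi$ there are countable subalgebras $R_\alpha,S_\alpha\subseteq\mathfrak{B}$ such that the inclusions $R_\alpha\subseteq B_\alpha\subseteq B_{\alpha+1}$, $R_\alpha\subseteq S_\alpha\subseteq B_{\alpha+1}$ form a push-out diagram. *)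

(* Defs.v *)
From HB Require Import structures.
From mathcomp Require Import all_boot all_order.
From mathcomp Require Import boolp classical_sets cardinality.
Set Implicit Arguments. Unset Strict Implicit. Unset Printing Implicit Defensive.
Import Order.Theory.
Local Open Scope classical_set_scope.
Local Open Scope order_scope.

Definition well_order_on (T : Type) (X : set T) (r : T -> T -> Prop) : Prop :=
  [/\ (forall x, X x -> r x x),
      (forall x y, X x -> X y -> r x y -> r y x -> x = y),
      (forall x y z, X x -> X y -> X z -> r x y -> r y z -> r x z),
      (forall x y, X x -> X y -> r x y \/ r y x) &
      (forall Y, Y `<=` X -> Y !=set0 -> exists2 m, Y m & forall y, Y y -> r m y)].

Definition init_seg (T : Type) (X : set T) (r : T -> T -> Prop) (x : T) : set T :=
  [set y | X y /\ r y x /\ y <> x].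

(* |X| <= omega_1 : X carries a well-order all of whose proper initial
   segments are countable (i.e. X injects into omega_1). *)
Definition card_le_omega1 (T : Type) (X : set T) : Prop :=
  exists r, well_order_on X r /\ forall x, X x -> countable (init_seg X r x).

(* |X| = omega_2 : X carries a well-order all of whose proper initial
   segments have size <= omega_1 (so |X| <= omega_2), and |X| > omega_1. *)
Definition card_eq_omega2 (T : Type) (X : set T) : Prop :=
  (exists r, well_order_on X r /\ forall x, X x -> card_le_omega1 (init_seg X r x))
  /\ ~ card_le_omega1 X.

Section BA.
Context {disp : Order.disp_t} {B : ctbDistrLatticeType disp}.

Definition is_subalgebra (A : set B) : Prop :=
  [/\ A \bot, A \top,
      (forall x y, A x -> A y -> A (Order.meet x y)),
      (forall x y, A x -> A y -> A (Order.join x y)) &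
      (forall x, A x -> A (Order.compl x))].

Definition gen_subalg (X : set B) : set B :=
  [set b | forall A : set B, is_subalgebra A -> X `<=` A -> A b].

Definition commute_subalg (A S : set B) : Prop :=
  forall a s, A a -> S s -> Order.meet a s = \bot ->
    exists b1 b2, [/\ setI A S b1, setI A S b2, a <= b1, s <= b2 &
                      Order.meet b1 b2 = \bot].

Definition pushout_diagram (R A S C : set B) : Prop :=
  [/\ is_subalgebra R, is_subalgebra A, is_subalgebra S & is_subalgebra C] /\
  [/\ R `<=` A, A `<=` C, R `<=` S & S `<=` C] /\
  [/\ gen_subalg (setU A S) = C, setI A S = R & commute_subalg A S].

End BA.

(* Tightly sigma-filtered.  The ordinal xi is represented by an index type
   [I] well-ordered by [le]; [lt] is the strict part.  *)
Definition tightly_sigma_filtered {disp : Order.disp_t}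
    (B : ctbDistrLatticeType disp) : Prop :=
  exists (I : Type) (le : I -> I -> Prop) (Bs : I -> set B),
    let lt := fun i j => le i j /\ i <> j in
    well_order_on setT le /\
    [/\ (forall i, is_subalgebra (Bs i)) &
        (forall i j, le i j -> Bs i `<=` Bs j)] /\
    [/\
        (forall i0, (forall j, le i0 j) -> Bs i0 = [set \bot; \top]),
        (forall b : B, exists i, Bs i b),
        (forall a, (exists j, lt j a) ->
                   (forall j, lt j a -> exists k, lt j k /\ lt k a) ->
                   Bs a = \bigcup_(j in [set j | lt j a]) Bs j) &
        (forall a b, lt a b -> (forall k, lt a k -> le b k) ->
           exists R S : set B, [/\ countable R, countable S &
                                   pushout_diagram R (Bs a) S (Bs b)])].

Inductive bpoly (n : nat) : Type :=
  | BVar of 'I_n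
  | BZero | BOne
  | BMeet of bpoly n & bpoly n
  | BJoin of bpoly n & bpoly n
  | BCompl of bpoly n.

Fixpoint bpoly_eval {disp : Order.disp_t} {B : ctbDistrLatticeType disp}
    (n : nat) (P : bpoly n) (a : 'I_n -> B) : B :=
  match P with
  | BVar i => a i
  | BZero => \bot
  | BOne => \top
  | BMeet p q => Order.meet (bpoly_eval p a) (bpoly_eval q a)
  | BJoin p q => Order.join (bpoly_eval p a) (bpoly_eval q a)
  | BCompl p => Order.compl (bpoly_eval p a)
  end.

(* Main.v *)
(* Let [gen_steps G] be the subalgebra generated by the countable pieces S_alpha with alpha in [G].
   Choose countable sets [D alpha] of indices below alpha such that [gen_steps (D alpha)] contains
   R_alpha. By induction along the filtration, if [G] and [G'] are closed under [D], disjoint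
   elements of [gen_steps G] and [gen_steps G'] are separated by an element of
   [gen_steps (G `&` G')]. Every H in the family lives over a countable [D]-closed set, and omega_2
   many of these sets have pairwise intersections inside one countable [D]-closed set [Gam] (this
   needs no CH, as the sets need not meet in exactly the same root). Then P(a_1, ..., a_n) = 0 with
   the a_i in different members is always witnessed by finitely many upper bounds, taken in the
   countable algebra [gen_steps Gam], for the literals of the minterms of P. Either one such
   witness works for omega_2 many H in each coordinate, which is (2), or deleting, for each of the
   countably many witnesses, the at most omega_1 many H it concerns in a suitable coordinate
   gives (1). *)

Require Import Defs.
From mathcomp Require Import all_boot all_order.
From mathcomp Require Import boolp classical_sets cardinality.
Set Implicit Arguments. Unset Strict Implicit. Unset Printing Implicit Defensive.
Import Order.Theory.
Local Open Scope classical_set_scope.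
Local Open Scope order_scope.
Local Open Scope classical_set_scope.

(** * Sets of size at most omega_1 and omega_2 *)

Lemma countable_preimage_inj (T U : Type) (A : set T) (C : set U) (f : T -> U) :
  (forall x, A x -> C (f x)) ->
  (forall x y, A x -> A y -> f x = f y -> x = y) ->
  countable C -> countable A.
Proof.
move=> AC finj /countable_injP[g ginj]; apply/countable_injP.
exists (g \o f) => x y /set_mem Ax /set_mem Ay /= gxy.
by apply: finj => //; apply: ginj => //; apply/mem_set; apply: AC.
Qed.

Lemma countable_sub (T : Type) (A C : set T) :
  A `<=` C -> countable C -> countable A.
Proof. by move=> AC; apply: (@countable_preimage_inj _ _ _ _ id). Qed.

Lemma countable_image (T U : Type) (f : T -> U) (A : set T) :
  countable A -> countable (f @` A).
Proof.
move=> cA; rewrite (_ : f @` A = \bigcup_(x in A) [set f x]).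
  exact: bigcup_countable.
by apply/seteqP; split=> [_ [x Ax <-]|y [x Ax ->]]; exists x.
Qed.

Lemma countableU (T : Type) (A C : set T) :
  countable A -> countable C -> countable (A `|` C).
Proof.
move=> cA cC; rewrite (_ : A `|` C = \bigcup_(b in [set: bool]) if b then A else C).
  by apply: bigcup_countable => // -[].
apply/seteqP; split=> [x [?|?]|x [[] _ ?]]; [by exists true|by exists false| |].
- by left.
- by right.
Qed.

Lemma countable_enumeration (T : Type) (A : set T) : countable A -> A !=set0 ->
  exists (e : nat -> T) (f : T -> nat),
    (forall k, A (e k)) /\ (forall x, A x -> e (f x) = x).
Proof.
move=> /countable_injP[f finj] [x0 Ax0].
have /choice[e eP] : forall k, exists x, A x /\ (forall y, A y -> f y = k -> x = y).
  move=> k; have [[y [Ay <-]]|ny] := pselect (exists y, A y /\ f y = k).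
    by exists y; split=> // z Az fz; apply: finj; rewrite ?fz //; apply/mem_set.
  by exists x0; split=> // y Ay fy; case: ny; exists y.
exists e, f; split=> [k|x Ax]; first by have [] := eP k.
by have [_] := eP (f x); apply.
Qed.

(** Well-foundedness holds on all of [T]: the predecessors of a point outside [X] still lie in [X].
    This lets [Fix] define total functions by recursion along [X]. *)
Lemma init_seg_wf (T : Type) (X : set T) (r : T -> T -> Prop) :
  well_order_on X r -> well_founded (fun y x => init_seg X r x y).
Proof.
move=> [rxx ranti _ _ rmin].
have accX x : X x -> Acc (fun y x => init_seg X r x y) x.
  move=> Xx; apply: contrapT => nacc.
  pose Y := [set z | X z /\ ~ Acc (fun y x => init_seg X r x y) z].
  have [//| |m [Xm nm] mmin] := rmin Y; [by move=> z []|by exists x|].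
  apply: nm; constructor => y [Xy [rym ynm]]; apply: contrapT => nay.
  by apply: ynm; apply: ranti => //; apply: mmin.
by move=> x; constructor => y [Xy _]; exact: accX.
Qed.

Lemma countable_init_segU (T : Type) (X : set T) (r : T -> T -> Prop) (x : T) :
  countable (init_seg X r x) -> countable [set y | X y /\ r y x].
Proof.
move=> cx; apply: (@countable_sub _ _ (init_seg X r x `|` [set x])).
  by move=> y [Xy ryx]; have [->|yx] := pselect (y = x); [right|left].
exact: countableU.
Qed.

(** Order [X] by rank first and, within a fibre, by an enumeration of that fibre. An initial segment
    is then covered by the countable fibres over the countably many ranks up to [rho x]. *)
Lemma card_le_omega1_rank (T U : Type) (X : set T) (W : set U)
    (s : U -> U -> Prop) (rho : T -> U) :
  well_order_on W s -> (forall w, W w -> countable (init_seg W s w)) ->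
  (forall x, X x -> W (rho x)) ->
  (forall w, W w -> countable [set x | X x /\ rho x = w]) ->
  card_le_omega1 X.
Proof.
move=> [sxx santi strans stot smin] cW XW cfib.
have /choice[c cinj] : forall w, exists f : T -> nat, W w ->
    forall x y, X x -> X y -> rho x = w -> rho y = w -> f x = f y -> x = y.
  move=> w; have [Ww|] := pselect (W w); last by exists (fun=> 0%N).
  have /countable_injP[f finj] := cfib w Ww.
  by exists f => _ x y Xx Xy xw yw; apply: finj; apply/mem_set.
pose r x y := (rho x <> rho y /\ s (rho x) (rho y)) \/
              (rho x = rho y /\ (c (rho x) x <= c (rho x) y)%N).
exists r; split; [split|].
- by move=> x _; right.
- move=> x y Xx Xy [[xy sxy]|[xy cxy]] [[yx syx]|[yx cyx]].
  + by case: xy; apply: santi => //; apply: XW.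
  + by case: xy.
  + by case: yx.
  + apply: (cinj _ (XW _ Xy)) => //.
    by apply/eqP; rewrite eqn_leq cyx -xy cxy.
- move=> x y z Xx Xy Xz [[xy sxy]|[xy cxy]] [[yz syz]|[yz cyz]].
  + left; split; last by apply: (strans _ (rho y)) => //; apply: XW.
    move=> xz; apply: xy; apply: santi; [exact: XW|exact: XW|done|].
    by rewrite xz.
  + by left; rewrite -yz.
  + by left; rewrite xy.
  + by right; split; [rewrite xy|apply: leq_trans cxy _; rewrite xy].
- move=> x y Xx Xy; have [xy|xy] := pselect (rho x = rho y).
    have [cxy|cyx] := leqP (c (rho x) x) (c (rho x) y); first by left; right.
    by right; right; rewrite -xy; split=> //; apply: ltnW.
  have [sxy|syx] := stot _ _ (XW _ Xx) (XW _ Xy); first by left; left.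
  by right; left; split=> // yx; apply: xy.
- move=> Y YX [y0 Yy0].
  have [| |m [y1 Yy1 <-] mmin] := smin (rho @` Y).
  + by move=> _ [y /YX/XW ? <-].
  + by exists (rho y0); exists y0.
  pose p k := `[< exists y, [/\ Y y, rho y = rho y1 & c (rho y1) y = k] >].
  have exp : exists k, p k by exists (c (rho y1) y1); apply/asboolP; exists y1.
  case: (ex_minnP exp) => k /asboolP[y' [Yy' y'y1 cy']] kmin.
  exists y' => // z Yz; rewrite /r y'y1.
  have [yz|yz] := pselect (rho y1 = rho z); last first.
    by left; split=> //; apply: mmin; exists z.
  by right; split=> //; rewrite cy'; apply: kmin; apply/asboolP; exists z.
- move=> x Xx.
  apply: (@countable_sub _ _ (\bigcup_(w in [set w | W w /\ s w (rho x)])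
                                [set z | X z /\ rho z = w])).
    move=> z [Xz [rzx _]]; exists (rho z) => //; split; first exact: XW.
    by case: rzx => [[]//|[-> _]]; apply/sxx/XW.
  apply: bigcup_countable; first exact/countable_init_segU/cW/XW.
  by move=> w [Ww _]; apply: cfib.
Qed.

Lemma card_le_omega1_inj (T U : Type) (X : set T) (Y : set U) (f : T -> U) :
  (forall x, X x -> Y (f x)) ->
  (forall x y, X x -> X y -> f x = f y -> x = y) ->
  card_le_omega1 Y -> card_le_omega1 X.
Proof.
move=> XY finj [s [wos cs]].
apply: (card_le_omega1_rank wos cs XY) => w _.
apply: (@countable_preimage_inj _ unit _ setT (fun=> tt)) => //.
by move=> x y [Xx <-] [Xy fyx] _; apply: finj.
Qed.

Lemma card_le_omega1_sub (T : Type) (X Y : set T) :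
  X `<=` Y -> card_le_omega1 Y -> card_le_omega1 X.
Proof. by move=> XY; apply: (@card_le_omega1_inj _ _ _ _ id). Qed.

Lemma well_order_on_nat : well_order_on [set: nat] (fun m n => (m <= n)%N).
Proof.
split=> //.
- by move=> x y _ _ xy yx; apply/eqP; rewrite eqn_leq xy yx.
- by move=> x y z _ _ _; apply: leq_trans.
- by move=> x y _ _; apply/orP; apply: leq_total.
move=> Y _ [y Yy].
have ex : exists k, `[< Y k >] by exists y; apply/asboolP.
case: (ex_minnP ex) => m /asboolP Ym mmin; exists m => // z Yz.
by apply: mmin; apply/asboolP.
Qed.

Lemma countable_card_le_omega1 (T : Type) (X : set T) :
  countable X -> card_le_omega1 X.
Proof.
move=> cX; apply: (@card_le_omega1_rank _ nat _ setT _ (fun=> 0%N) well_order_on_nat) => //.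
by move=> w _; apply: countable_sub cX => x [].
Qed.

(* A fresh point of [W] can be chosen at each step, since only countably many are already taken. *)
Lemma card_le_omega1_inj_uncountable (T U : Type) (X : set T) (W : set U) :
  ~ countable W -> card_le_omega1 X ->
  exists f : T -> U, (forall x, X x -> W (f x)) /\
                     (forall x y, X x -> X y -> f x = f y -> x = y).
Proof.
move=> ncW [r [wor cr]].
have [u0 Wu0] : W !=set0.
  by apply/set0P/eqP => W0; apply: ncW; rewrite W0.
have /choice[pick pickP] : forall C : set U, exists w, countable C -> W w /\ ~ C w.
  move=> C; have [cC|] := pselect (countable C); last by exists u0.
  suff [w [Ww Cw]] : exists w, W w /\ ~ C w by exists w.
  apply: contrapT => nex; apply: ncW; apply: countable_sub cC => w Ww.
  by apply: contrapT => nCw; apply: nex; exists w.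
pose step x (rec : forall y, init_seg X r x y -> U) :=
  pick [set u | exists y (p : init_seg X r x y), rec y p = u].
pose f := Fix (init_seg_wf wor) (fun=> U) step.
have fE x : f x = pick (f @` init_seg X r x).
  rewrite /f Fix_eq; last first.
    move=> {}x g h gh; rewrite /step; congr pick; apply/seteqP.
    by split=> u [y [p <-]]; exists y, p.
  rewrite /step; congr pick; apply/seteqP; split=> [u [y [p <-]]|u [y p <-]].
    by exists y.
  by exists y, p.
have fP x : X x -> W (f x) /\ ~ (f @` init_seg X r x) (f x).
  by move=> Xx; rewrite fE; apply: pickP; apply/countable_image/cr.
exists f; split=> [x /fP[]//|x y Xx Xy fxy].
apply: contrapT => nxy; have [_ _ _ rtot _] := wor.
have [rxy|ryx] := rtot _ _ Xx Xy.
  by have [_] := fP y Xy; apply; exists x.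
by have [_] := fP x Xx; apply; exists y => //; split=> //; split=> // yx; apply: nxy.
Qed.

(** The argument for omega_1 * omega_1 = omega_1: code a point by a pair in a copy [W] of omega_1
    and rank it by the maximum. Pairs of maximum [w] lie in the countable square of the segment up
    to [w]. *)
Lemma card_le_omega1_bigcup (I T : Type) (D : set I) (F : I -> set T) :
  card_le_omega1 D -> (forall i, D i -> card_le_omega1 (F i)) ->
  card_le_omega1 (\bigcup_(i in D) F i).
Proof.
move=> oD oF.
(* An uncountable [D] or an uncountable [F i] will serve as [W]; if there is none, the union is
   countable. *)
have main U (W : set U) : card_le_omega1 W -> ~ countable W ->
    card_le_omega1 (\bigcup_(i in D) F i).
  move=> [s [wos cs]] ncW.
  have [iD [iDW iDinj]] := card_le_omega1_inj_uncountable ncW oD.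
  have /choice[j jP] : forall i, exists f : T -> U, D i ->
      (forall x, F i x -> W (f x)) /\
      (forall x y, F i x -> F i y -> f x = f y -> x = y).
    move=> i; have [Di|] := pselect (D i); last by exists (fun=> iD i).
    by have [f fP] := card_le_omega1_inj_uncountable ncW (oF i Di); exists f.
  have [i0|D0] := pselect (exists i, D i); last first.
    by apply: countable_card_le_omega1; apply: countable_sub (countable0 _) => x [i Di];
       case: D0; exists i.
  have /choice[d dP] : forall x, exists i, (\bigcup_(i in D) F i) x -> D i /\ F i x.
    by move=> x; have [[i Di Fx]|] := pselect ((\bigcup_(i in D) F i) x);
       [exists i|have [i _] := i0; exists i].
  pose u x := iD (d x); pose v x := j (d x) x.
  have uW x : (\bigcup_(i in D) F i) x -> W (u x) by move=> /dP[? _]; apply: iDW.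
  have vW x : (\bigcup_(i in D) F i) x -> W (v x).
    by move=> /dP[Dd Fd]; apply: (jP _ Dd).1.
  have [sxx _ _ stot _] := wos.
  pose rho x := if `[< s (u x) (v x) >] then v x else u x.
  have urho x : (\bigcup_(i in D) F i) x -> s (u x) (rho x).
    by move=> ux; rewrite /rho; case: asboolP => // _; apply/sxx/uW.
  have vrho x : (\bigcup_(i in D) F i) x -> s (v x) (rho x).
    move=> ux; rewrite /rho; case: asboolP => [_|nuv]; first exact/sxx/vW.
    by have [] := stot _ _ (uW _ ux) (vW _ ux).
  apply: (@card_le_omega1_rank _ _ _ _ _ rho wos cs).
    by move=> x ux; rewrite /rho; case: asboolP => _; [apply: vW|apply: uW].
  move=> w Ww; have cw := countable_init_segU (cs w Ww).
  apply: (@countable_preimage_inj _ _ _ _ (fun x => (u x, v x)) _ _ (countableX cw cw)).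
    move=> x [ux <-]; split; split=> /=; [exact: uW|exact: urho|exact: vW|exact: vrho].
  move=> x y [ux _] [uy _] [uxy vxy].
  have [Dx Fx] := dP _ ux; have [Dy Fy] := dP _ uy.
  have dxy := iDinj _ _ Dx Dy uxy.
  by apply: (jP _ Dx).2 => //; [rewrite dxy|move: vxy; rewrite /v dxy].
have [cD|] := pselect (countable D); last exact: main.
have [cF|] := pselect (forall i, D i -> countable (F i)).
  exact/countable_card_le_omega1/bigcup_countable.
by move=> /existsNP[i /not_implyP[Di ncF]]; apply: main ncF; apply: oF.
Qed.

Lemma card_le_omega1U (T : Type) (X Y : set T) :
  card_le_omega1 X -> card_le_omega1 Y -> card_le_omega1 (X `|` Y).
Proof.
move=> oX oY.
apply: (@card_le_omega1_sub _ _ (\bigcup_(b in [set: bool]) if b then X else Y)).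
  by move=> x [?|?]; [exists true|exists false].
by apply: card_le_omega1_bigcup => [|[]//]; exact: countable_card_le_omega1.
Qed.

Lemma card_eq_omega2_sub (T : Type) (X Y : set T) :
  Y `<=` X -> card_eq_omega2 X -> ~ card_le_omega1 Y -> card_eq_omega2 Y.
Proof.
move=> YX [[r [[rxx ranti rtrans rtot rmin] cr]] _] nY; split=> //.
exists r; split; first split.
- by move=> x /YX; apply: rxx.
- by move=> x y /YX Xx /YX; apply: ranti.
- by move=> x y z /YX Xx /YX Xy /YX; apply: rtrans.
- by move=> x y /YX Xx /YX; apply: rtot.
- by move=> Z ZY; apply: rmin => z /ZY/YX.
move=> x /YX/cr; apply: card_le_omega1_sub => y [/YX Xy ?]; by split.
Qed.

(** Supplies a copy of omega_1 to iterate along: were all proper initial segments countable, the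
    order itself would show that [X] has size at most omega_1. *)
Lemma uncountable_card_le_omega1_of_omega2 (T : Type) (X : set T) :
  card_eq_omega2 X -> exists W : set T, card_le_omega1 W /\ ~ countable W.
Proof.
move=> [[r [wor or]] nX]; apply: contrapT => nW; apply: nX; exists r; split=> // x Xx.
by apply: contrapT => nc; apply: nW; exists (init_seg X r x); split=> //; apply: or.
Qed.

(** * Families with a countable root *)

(* Let [M Delta] be a maximal family with pairwise intersections inside [Delta]. If [M Delta] had
   size at most omega_1 for every [Delta] of size at most omega_1, one could iterate
   [Delta |-> Delta `|` \bigcup_(x in M Delta) G x] along omega_1, and any [x] outside all these
   families would have a point of [G x] in each of the omega_1 many increments. *)
Lemma omega2_root_omega1 (T I : Type) (K : set T) (G : T -> set I) :
  card_eq_omega2 K -> (forall x, K x -> countable (G x)) ->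
  exists K' (Delta : set I), [/\ K' `<=` K, ~ card_le_omega1 K',
    card_le_omega1 Delta &
    forall x y, K' x -> K' y -> x <> y -> G x `&` G y `<=` Delta].
Proof.
move=> K2 cG; apply: contrapT => nroot.
pose fam (Delta : set I) (M : set T) := M `<=` K /\
  forall x y, M x -> M y -> x <> y -> G x `&` G y `<=` Delta.
have /choice[M MP] : forall Delta, exists M, fam Delta M /\
    forall M', M `<` M' -> ~ fam Delta M'.
  (* The condition concerns two members at a time, so it passes to unions of chains. *)
  move=> Delta; apply: Zorn_bigcup => F Ffam Ftot; split.
    by move=> x [X /Ffam[XK _] Xx]; apply: XK.
  move=> x y [X FX Xx] [Y FY Yy] xy.
  have [XY|YX] := Ftot _ _ FX FY.
    by apply: (Ffam _ FY).2 => //; apply: XY.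
  by apply: (Ffam _ FX).2 => //; apply: YX.
have Mle Delta : card_le_omega1 Delta -> card_le_omega1 (M Delta).
  move=> oD; apply: contrapT => nM; apply: nroot; exists (M Delta), Delta.
  by have [[MK Msep] _] := MP Delta.
have [W [[r [wor cr]] ncW]] := uncountable_card_le_omega1_of_omega2 K2.
pose N (Delta : set I) := \bigcup_(x in M Delta) G x.
pose step w (rec : forall v, init_seg W r w v -> set I) : set I :=
  [set i | exists v (p : init_seg W r w v), N (rec v p) i].
pose Dl := Fix (init_seg_wf wor) (fun=> set I) step.
have DlE w : Dl w = \bigcup_(v in init_seg W r w) N (Dl v).
  rewrite /Dl Fix_eq; last first.
    by move=> {}w g h gh; apply/seteqP; split=> i [v [p Ni]]; exists v, p;
       move: Ni; rewrite gh.
  by apply/seteqP; split=> i [v]; [case=> p ?; exists v|move=> p ?; exists v, p].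
have Dl1 w : W w -> card_le_omega1 (Dl w).
  elim/(well_founded_ind (init_seg_wf wor)): w => w IH Ww; rewrite DlE.
  apply: card_le_omega1_bigcup => [|v wv]; first exact/countable_card_le_omega1/cr.
  have Wv : W v by case: wv.
  apply: card_le_omega1_bigcup => [|x Mx]; first exact/Mle/IH.
  apply/countable_card_le_omega1/cG.
  by have [[MK _] _] := MP (Dl v); apply: MK.
have [x Kx xM] : exists2 x, K x & forall w, W w -> ~ M (Dl w) x.
  apply: contrapT => nx; apply: K2.2.
  apply: (@card_le_omega1_sub _ _ (\bigcup_(w in W) M (Dl w))).
    move=> x Kx; apply: contrapT => nMx; apply: nx; exists x => // w Ww Mx.
    by apply: nMx; exists w.
  by apply: card_le_omega1_bigcup => [|w Ww]; [exists r|exact/Mle/Dl1].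
(* By maximality [x] cannot be added to [M (Dl w)], so [G x] meets some [G y], with [y] in that
   family, outside [Dl w]. *)
have zP w : W w -> exists i, [/\ G x i, N (Dl w) i & ~ Dl w i].
  move=> Ww; apply: contrapT => nz.
  have [[MK Msep] Mmax] := MP (Dl w).
  have xsep y : M (Dl w) y -> G x `&` G y `<=` Dl w.
    move=> My i [xi yi]; apply: contrapT => nDi; apply: nz; exists i.
    by split=> //; exists y.
  apply: (Mmax (M (Dl w) `|` [set x])).
    split=> [y My|sub]; first by left.
    by apply: (xM w Ww); apply: sub; right.
  split=> [y [/MK//|->//]|y z [My|->] [Mz|->] yz].
  - exact: Msep.
  - by rewrite setIC; apply: xsep.
  - exact: xsep.
  - by case: yz.
have /choice[z zP'] : forall w, exists i, W w -> [/\ G x i, N (Dl w) i & ~ Dl w i].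
  move=> w; have [Ww|nw] := pselect (W w); first by have [i] := zP w Ww; exists i.
  have [w0 Ww0] : W !=set0 by apply/set0P/eqP => W0; apply: ncW; rewrite W0.
  by have [i _] := zP _ Ww0; exists i.
apply: ncW; apply: (@countable_preimage_inj _ _ _ _ z _ _ (cG x Kx)).
  by move=> w /zP'[].
(* The point [z v] has been absorbed into [Dl w] at the later stage [w], while [z w] lies outside
   [Dl w]. Hence [z] embeds the uncountable [W] into the countable [G x]. *)
have lt_neq v w : W v -> W w -> r v w -> v <> w -> z v <> z w.
  move=> Wv Ww rvw vw zvw; have [_ Nv _] := zP' v Wv; have [_ _] := zP' w Ww.
  by apply; rewrite DlE -zvw; exists v.
have [_ _ _ rtot _] := wor.
move=> v w Wv Ww zvw; apply: contrapT => vw.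
have [rvw|rwv] := rtot _ _ Wv Ww; first exact: lt_neq zvw.
by apply: (lt_neq w v) => // wv; apply: vw.
Qed.

(** If [Delta] is uncountable, it is ordered like omega_1, so the countable trace of [G x] on it
    lies strictly below some [d]. There are at most omega_1 many [d], so one of them serves more
    than omega_1 many [x], and its initial segment is the new root. *)
Lemma omega2_root_countable (T I : Type) (K : set T) (G : T -> set I) :
  card_eq_omega2 K -> (forall x, K x -> countable (G x)) ->
  exists K' (Gamma : set I), [/\ K' `<=` K, card_eq_omega2 K',
    countable Gamma &
    forall x y, K' x -> K' y -> x <> y -> G x `&` G y `<=` Gamma].
Proof.
move=> K2 cG.
have [K' [Delta [K'K nK' [r [wor cr]] sep]]] := omega2_root_omega1 K2 cG.
have K'2 := card_eq_omega2_sub K'K K2 nK'.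
have [cD|ncD] := pselect (countable Delta); first by exists K', Delta.
pose Kd d := [set x | K' x /\ G x `&` Delta `<=` init_seg Delta r d].
have [d Dd nKd] : exists2 d, Delta d & ~ card_le_omega1 (Kd d).
  apply: contrapT => nd; apply: nK'.
  apply: (@card_le_omega1_sub _ _ (\bigcup_(d in Delta) Kd d)); last first.
    apply: card_le_omega1_bigcup => [|d Dd]; first by exists r.
    by apply: contrapT => nKd; apply: nd; exists d.
  (* A trace bounded by no [d] is cofinal, which would make [Delta] a countable union of countable
     segments. *)
  move=> x K'x; apply: contrapT => nx; apply: ncD.
  apply: (@countable_sub _ _
    (\bigcup_(i in G x `&` Delta) [set d | Delta d /\ r d i])).
    move=> d Dd; apply: contrapT => nid; apply: nx; exists d => //.
    split=> // i [xi Di]; have [_ _ _ rtot _] := wor.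
    have [rid|rdi] := rtot _ _ Di Dd; last by case: nid; exists i.
    split=> //; split=> // id; apply: nid; exists d; last first.
      by split=> //; case: wor => rxx *; apply: rxx.
    by rewrite -id.
  apply: bigcup_countable => [|i [_ Di]]; last exact/countable_init_segU/cr.
  by apply: countable_sub (cG x (K'K _ K'x)) => i [].
exists (Kd d), (init_seg Delta r d); split.
- by move=> x [/K'K].
- by apply: (card_eq_omega2_sub _ K'2 nKd) => x [].
- exact: cr.
- move=> x y [K'x xd] [K'y _] xy i [xi yi]; apply: xd; split=> //.
  exact: (sep x y).
Qed.

Local Open Scope order_scope.

(** * Generated subalgebras and separation *)

Section Subalgebras.
Context {disp : Order.disp_t} {B : ctbDistrLatticeType disp}.
Implicit Types (a b s t x y : B) (A S X Y : set B).

Lemma is_subalgebra_gen X : is_subalgebra (gen_subalg X).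
Proof.
split=> [A [] //|A [] //|x y Xx Xy A sA XA|x y Xx Xy A sA XA|x Xx A sA XA];
  have [_ _ AI AU AC] := sA.
- by apply: AI; [apply: Xx|apply: Xy].
- by apply: AU; [apply: Xx|apply: Xy].
- by apply: AC; apply: Xx.
Qed.

Lemma sub_gen_subalg X : (X `<=` gen_subalg X)%classic.
Proof. by move=> x Xx A _; apply. Qed.

Lemma gen_subalg_min X A :
  is_subalgebra A -> (X `<=` A)%classic -> (gen_subalg X `<=` A)%classic.
Proof. by move=> sA XA x; apply. Qed.

Lemma gen_subalg_mono X Y :
  (X `<=` Y)%classic -> (gen_subalg X `<=` gen_subalg Y)%classic.
Proof.
move=> XY; apply: gen_subalg_min; first exact: is_subalgebra_gen.
by move=> x /XY; apply: sub_gen_subalg.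
Qed.

Lemma countable_gen_subalg X : countable X -> countable (gen_subalg X).
Proof.
move=> cX.
pose step Y : set B := (Y `|` [set ~` x | x in Y]%O `|`
  [set x.1 `&` x.2 | x in Y `*` Y]%O `|` [set x.1 `|` x.2 | x in Y `*` Y]%O)%classic.
pose X0 : set B := (X `|` [set \bot; \top])%classic.
have cn n : countable (iter n step X0).
  elim: n => [|n IHn] /=.
    by do 2 ?apply: countableU.
  have c2 := countableX IHn IHn.
  by do 3 ?[apply: countableU => //]; exact: countable_image.
have stepS Y : (Y `<=` step Y)%classic by move=> y Yy; left; left; left.
have mono m n : (m <= n)%N -> (iter m step X0 `<=` iter n step X0)%classic.
  move=> /subnK <-; elim: (n - m)%N => [//|k IHk] x /IHk; exact: stepS.
apply: (@countable_sub _ _ (\bigcup_n iter n step X0)); last exact: bigcup_countable.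
apply: gen_subalg_min => [|x Xx]; last by exists 0%N => //; left.
have join2 x y : (\bigcup_n iter n step X0) x -> (\bigcup_n iter n step X0) y ->
    exists n, iter n step X0 x /\ iter n step X0 y.
  move=> [m _ mx] [n _ ny]; exists (maxn m n); split.
    exact: mono (leq_maxl m n) _ mx.
  exact: mono (leq_maxr m n) _ ny.
split.
- by exists 0%N => //; right; left.
- by exists 0%N => //; right; right.
- move=> x y /join2 h /h[n [nx ny]]; exists n.+1 => //.
  by left; right; exists (x, y).
- move=> x y /join2 h /h[n [nx ny]]; exists n.+1 => //.
  by right; exists (x, y).
- by move=> x [n _ nx]; exists n.+1 => //; left; left; right; exists x.
Qed.

Inductive finite_joins X : B -> Prop :=
| finite_joins0 : finite_joins X \bot
| finite_joinsS x y : X x -> finite_joins X y -> finite_joins X (x `|` y).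

Lemma finite_joins1 X x : X x -> finite_joins X x.
Proof. by move=> Xx; rewrite -[x]joinx0; do 2?constructor. Qed.

Lemma finite_joinsU X x y :
  finite_joins X x -> finite_joins X y -> finite_joins X (x `|` y).
Proof.
by elim=> [|u v Xu _ IH] Xy; rewrite ?join0x// -joinA; constructor => //; apply: IH.
Qed.

Lemma finite_joinsI X x y : (forall u v, X u -> X v -> X (u `&` v)) ->
  finite_joins X x -> finite_joins X y -> finite_joins X (x `&` y).
Proof.
move=> XI; elim=> [|u v Xu _ IH] Xy; first by rewrite meet0x; constructor.
rewrite meetUl; apply: finite_joinsU; last exact: IH.
elim: Xy => [|w z Xw _ IHw]; first by rewrite meetx0; constructor.
by rewrite meetUr; constructor => //; apply: XI.
Qed.

(** Finite joins of products are closed under meets by distributivity, and under complements by De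
    Morgan, since the complement of a product is a join of two one-sided products. *)
Lemma gen_subalgU_finite_joins A S : is_subalgebra A -> is_subalgebra S ->
  (gen_subalg (setU A S) `<=`
     finite_joins [set z | exists x t, [/\ A x, S t & z = (x `&` t)%O]])%classic.
Proof.
move=> [A0 A1 AI AU AC] [S0 S1 SI SU SC].
set X := [set z | _].
have XI u v : X u -> X v -> X (u `&` v).
  move=> [x [t [Ax St ->]]] [y [s [Ay Ss ->]]].
  by exists (x `&` y), (t `&` s); split; [exact: AI|exact: SI|rewrite meetACA].
have XA x : A x -> X x by move=> Ax; exists x, \top; rewrite meetx1.
have XS t : S t -> X t by move=> St; exists \top, t; rewrite meet1x.
apply: gen_subalg_min => [|z [/XA|/XS]]; [|exact: finite_joins1..].
split.
- by constructor.
- exact/finite_joins1/XA.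
- by move=> x y; apply: finite_joinsI.
- exact: finite_joinsU.
move=> x; elim=> [|u v [y [t [Ay St ->]]] _ IH].
  by rewrite compl0; apply/finite_joins1/XA.
rewrite complU; apply: finite_joinsI => //; rewrite complI.
by apply: finite_joinsU; apply: finite_joins1; [apply/XA/AC|apply/XS/SC].
Qed.

(** A one-sided form of the conclusion of [commute_subalg]: when [E] is a subalgebra, [b] and its
    complement are the two required bounds. *)
Definition separated_by (E : set B) a s :=
  exists b, [/\ E b, a <= b & b `&` s = \bot].

Lemma separated_by_sub (E F : set B) a s :
  (E `<=` F)%classic -> separated_by E a s -> separated_by F a s.
Proof. by move=> EF [b [/EF ? ? ?]]; exists b. Qed.

Lemma separated_by_sym E a s :
  is_subalgebra E -> separated_by E a s -> separated_by E s a.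
Proof.
move=> [_ _ _ _ EC] [b [Eb ab bs]]; exists (~` b); split; first exact: EC.
  by rewrite -disj_leC meetC bs.
by apply/eqP; rewrite meetC disj_leC complK.
Qed.

Lemma separated_by_joinsl E X a s : is_subalgebra E ->
  (forall x, X x -> x `&` s = \bot -> separated_by E x s) ->
  finite_joins X a -> a `&` s = \bot -> separated_by E a s.
Proof.
move=> [E0 _ _ EU _] XE; elim=> [_|x y Xx _ IH].
  by exists \bot; rewrite meet0x.
rewrite meetUl => /eqP; rewrite join_eq0 => /andP[/eqP xs /eqP ys].
have [b [Eb xb bs]] := XE x Xx xs; have [c [Ec yc cs]] := IH ys.
exists (b `|` c); split; [exact: EU|exact: leU2|].
by rewrite meetUl bs cs joinxx.
Qed.

(** Reduces separation in an algebra generated by two subalgebras to separation of single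
    products. *)
Lemma separated_by_joins E X Y a s : is_subalgebra E ->
  (forall x y, X x -> Y y -> x `&` y = \bot -> separated_by E x y) ->
  finite_joins X a -> finite_joins Y s -> a `&` s = \bot -> separated_by E a s.
Proof.
move=> sE XY Xa Ys; apply: (separated_by_joinsl sE _ Xa) => x Xx.
rewrite meetC => sx; apply: separated_by_sym => //.
apply: (separated_by_joinsl sE _ Ys) sx => y Yy yx.
by apply: separated_by_sym => //; apply: XY => //; rewrite meetC.
Qed.

End Subalgebras.

(** * Subalgebras generated by closed sets of steps *)

Section Skeleton.
Context {disp : Order.disp_t} {B : ctbDistrLatticeType disp}.
Variables (I : Type) (le : I -> I -> Prop) (S : I -> set B) (D : I -> set I).

Definition gen_steps (G : set I) : set B := gen_subalg (\bigcup_(i in G) S i).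

(* [S i] is the paper's S_alpha; [D i] is a countable set of earlier indices whose steps
   already generate the paper's R_alpha. *)
Definition skeleton : Prop :=
  [/\ well_order_on setT le,
      (forall i, is_subalgebra (S i) /\ countable (S i)),
      (forall i, countable (D i) /\ (D i `<=` init_seg setT le i)%classic),
      (forall i t x, S i t -> gen_steps (init_seg setT le i) x ->
         t `&` x = \bot -> separated_by (gen_steps (D i)) t x) &
      (forall b, exists2 G, countable G & gen_steps G b)].

Definition D_closed (G : set I) : Prop := forall i, G i -> (D i `<=` G)%classic.

Lemma is_subalgebra_gen_steps G : is_subalgebra (gen_steps G).
Proof. exact: is_subalgebra_gen. Qed.

Lemma gen_steps_mono G G' :
  (G `<=` G')%classic -> (gen_steps G `<=` gen_steps G')%classic.
Proof. by move=> GG'; apply: gen_subalg_mono => x [i /GG' G'i Six]; exists i. Qed.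

Lemma gen_steps_setU1 G i : is_subalgebra (S i) ->
  (gen_steps (setU G [set i]) `<=` gen_subalg (setU (gen_steps G) (S i)))%classic.
Proof.
move=> sSi; apply: gen_subalg_min; first exact: is_subalgebra_gen.
move=> x [j [Gj|->] Sjx]; apply: sub_gen_subalg; last by right.
by left; apply: sub_gen_subalg; exists j.
Qed.

Lemma gen_steps_countable_support G b :
  gen_steps G b -> exists G', [/\ (G' `<=` G)%classic, countable G' & gen_steps G' b].
Proof.
have sub2 G1 G2 : [/\ (G1 `<=` G)%classic & countable G1] ->
    [/\ (G2 `<=` G)%classic & countable G2] ->
    [/\ (setU G1 G2 `<=` G)%classic & countable (setU G1 G2)].
  by move=> [s1 c1] [s2 c2]; split; [move=> x [/s1|/s2]|exact: countableU].
apply: (@gen_subalg_min _ _ _ [set b | _]); last first.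
  move=> x [i Gi Six]; exists [set i]; split=> [_ ->//|//|].
  by apply: sub_gen_subalg; exists i.
have up1 G1 G2 : (gen_steps G1 `<=` gen_steps (setU G1 G2))%classic.
  by apply: gen_steps_mono => x; left.
have up2 G1 G2 : (gen_steps G2 `<=` gen_steps (setU G1 G2))%classic.
  by apply: gen_steps_mono => x; right.
split=> [||x y [G1 [s1 c1 g1]] [G2 [s2 c2 g2]]|x y [G1 [s1 c1 g1]] [G2 [s2 c2 g2]]|
         x [G1 [s1 c1 g1]]].
- by exists set0; split=> //; case: (is_subalgebra_gen_steps set0).
- by exists set0; split=> //; case: (is_subalgebra_gen_steps set0).
- have [s c] := sub2 G1 G2 (conj s1 c1) (conj s2 c2).
  exists (setU G1 G2); split=> //; case: (is_subalgebra_gen_steps (setU G1 G2)) => _ _ gI _ _.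
  by apply: gI; [apply: up1|apply: up2].
- have [s c] := sub2 G1 G2 (conj s1 c1) (conj s2 c2).
  exists (setU G1 G2); split=> //; case: (is_subalgebra_gen_steps (setU G1 G2)) => _ _ _ gU _.
  by apply: gU; [apply: up1|apply: up2].
- by exists G1; split=> //; case: (is_subalgebra_gen_steps G1) => _ _ _ _ gC; apply: gC.
Qed.

Hypothesis skel : skeleton.

Let wo_le : well_order_on setT le. Proof. by case: skel. Qed.

Lemma countable_gen_steps G : countable G -> countable (gen_steps G).
Proof.
move=> cG; apply: countable_gen_subalg; apply: bigcup_countable => // i _.
by case: skel => _ /(_ i)[].
Qed.

Lemma D_closed_hull G : countable G ->
  exists G', [/\ (G `<=` G')%classic, countable G' & D_closed G'].
Proof.
move=> cG; pose step X : set I := setU X (\bigcup_(i in X) D i).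
exists (\bigcup_n iter n step G); split.
- by move=> i Gi; exists 0%N.
- apply: bigcup_countable => // n _; elim: n => [//|n IHn] /=.
  apply: countableU => //; apply: bigcup_countable => // i _.
  by case: skel => _ _ /(_ i)[].
- move=> i [n _ Gi] j Dij; exists n.+1 => //=; right; by exists i.
Qed.

Definition separation (G G' F : set I) : Prop :=
  forall a s, gen_steps G a -> gen_steps G' s -> a `&` s = \bot ->
    separated_by (gen_steps F) a s.

Lemma separation_sym G G' F : separation G G' F -> separation G' G F.
Proof.
move=> sep s a Gs Ga sa; apply: separated_by_sym; first exact: is_subalgebra_gen_steps.
by apply: sep => //; rewrite meetC.
Qed.

Local Notation below i := (init_seg setT le i).
Local Notation upto i := [set j | le j i].

Lemma uptoE i : upto i = setU (below i) [set i].
Proof.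
have [lexx _ _ _ _] := wo_le.
apply/seteqP; split=> [j /= ji|j [[_ []]//|->]]; last exact: lexx.
by have [->|] := pselect (j = i); [right|left].
Qed.

(** For a product of [x] over [G] below [i] with [t] in [S i], the skeleton yields [r] above [t] and
    disjoint from the meet of [x] and [s]. As [G] is closed, [r] lives over [G] below [i], so the
    hypothesis separates the meet of [x] and [r] from [s]. *)
Lemma separation_step_one G G' i : D_closed G -> G i ->
  separation (setI G (below i)) (setI G' (below i)) (setI (setI G G') (below i)) ->
  separation (setU (setI G (below i)) [set i]) (setI G' (below i))
    (setI (setI G G') (below i)).
Proof.
move=> clG Gi sep a s Ga G's as0.
have [_ /(_ i)[sSi _] /(_ i)[_ Db] /(_ i) po _] := skel.
have sG := is_subalgebra_gen_steps (setI G (below i)).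
have Ja := gen_subalgU_finite_joins sG sSi (gen_steps_setU1 sSi Ga).
apply: separated_by_joinsl (is_subalgebra_gen_steps _) _ Ja as0.
move=> _ [x [t [Gx St ->]]] xts.
have [_ _ bI _ _] := is_subalgebra_gen_steps (below i).
have [||r [Dr tr rxs]] := po t (x `&` s) St.
- by apply: bI; [apply: gen_steps_mono Gx|apply: gen_steps_mono G's] => j [].
- by rewrite meetCA meetA.
have Gr : gen_steps (setI G (below i)) r.
  by apply: gen_steps_mono Dr => j Dj; split; [apply: clG Dj|apply: Db].
have [_ _ gI _ _] := sG.
have [|b [Fb xrb bs]] := sep (x `&` r) s (gI _ _ Gx Gr) G's.
  by rewrite -meetA meetCA.
exists b; split=> //; apply: le_trans xrb.
exact: leI2.
Qed.

(** For products [x], [t] and [y], [u], first take [r] above the meet of [t] and [u] and disjoint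
    from the meet of [x] and [y]; closedness of both sets puts [r] over the intersection. If [b]
    separates the meet of [x] and [r] from [y], the meet of [t] with the join of [b] and the
    complement of [r] is the separator: its [b] part misses [y], the rest misses [u]. *)
Lemma separation_step_both G G' i : D_closed G -> D_closed G' -> G i -> G' i ->
  separation (setI G (below i)) (setI G' (below i)) (setI (setI G G') (below i)) ->
  separation (setU (setI G (below i)) [set i]) (setU (setI G' (below i)) [set i])
    (setU (setI (setI G G') (below i)) [set i]).
Proof.
move=> clG clG' Gi G'i sep a s Ga G's as0.
have [_ /(_ i)[sSi _] /(_ i)[_ Db] /(_ i) po _] := skel.
have sG := is_subalgebra_gen_steps (setI G (below i)).
have sG' := is_subalgebra_gen_steps (setI G' (below i)).
have Ja := gen_subalgU_finite_joins sG sSi (gen_steps_setU1 sSi Ga).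
have Js := gen_subalgU_finite_joins sG' sSi (gen_steps_setU1 sSi G's).
set F := setU _ _; have sF := is_subalgebra_gen_steps F.
apply: (separated_by_joins sF _ Ja Js as0).
move=> _ _ [x [t [Gx St ->]]] [y [u [Gy Su ->]]] xtyu.
have [_ _ bI _ _] := is_subalgebra_gen_steps (below i).
have [_ _ SI _ _] := sSi.
have [||r [Dr tur rxy]] := po (t `&` u) (x `&` y) (SI _ _ St Su).
- by apply: bI; [apply: gen_steps_mono Gx|apply: gen_steps_mono Gy] => j [].
- by rewrite meetC meetACA.
have Gr : gen_steps (setI (setI G G') (below i)) r.
  apply: gen_steps_mono Dr => j Dj; split; last exact: Db.
  by split; [apply: clG Dj|apply: clG' Dj].
have Gxr : gen_steps (setI G (below i)) (x `&` r).
  have [_ _ gI _ _] := sG; apply: gI => //.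
  by apply: gen_steps_mono Gr => j [[]].
have [|b [Fb xrb bs]] := sep (x `&` r) y Gxr Gy.
  by rewrite -meetA meetCA.
have [_ _ FI FU FC] := sF.
have inF z : gen_steps (setI (setI G G') (below i)) z -> gen_steps F z.
  by apply: gen_steps_mono => j; left.
have FS : gen_steps F t by apply: sub_gen_subalg; exists i => //; right.
exists (t `&` (b `|` ~` r)); split.
- exact: (FI _ _ FS (FU _ _ (inF _ Fb) (FC _ (inF _ Gr)))).
- rewrite meetC; apply: leI2 => //.
  by rewrite -[x in x <= _](meetx1) -(joinxC r) meetUr; apply: leU2 => //; apply: leIr.
- rewrite -meetA meetUl joinC.
  rewrite (_ : b `&` (y `&` u) = \bot); last by rewrite meetA bs meet0x.
  rewrite joinx0; apply/eqP; rewrite -lex0.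
  rewrite (_ : t `&` _ = (t `&` u) `&` ~` r `&` y); last first.
    by rewrite -!meetA; congr (_ `&` _); rewrite [y `&` u]meetC meetCA.
  rewrite lex0; apply/eqP.
  suff -> : (t `&` u) `&` ~` r = \bot by rewrite meet0x.
  by apply/eqP; rewrite disj_leC complK.
Qed.

(** An element involves finitely many steps, which have a largest index. Nonemptiness of [L]
    provides a stage for the constants. *)
Lemma gen_steps_upto (G L : set I) b : L !=set0 -> gen_steps (setI G L) b ->
  exists2 i, L i & gen_steps (setI G (upto i)) b.
Proof.
move=> [i0 Li0].
have [lexx _ letrans letot _] := wo_le.
have up i j : le i j ->
    (gen_steps (setI G (upto i)) `<=` gen_steps (setI G (upto j)))%classic.
  move=> ij; apply: gen_steps_mono => k [Gk ki]; split=> //.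
  exact: (letrans k i j).
have max2 x y i j : L i -> L j -> gen_steps (setI G (upto i)) x ->
    gen_steps (setI G (upto j)) y ->
    exists k, [/\ L k, gen_steps (setI G (upto k)) x & gen_steps (setI G (upto k)) y].
  move=> Li Lj Gx Gy; have [ij|ji] := letot i j Logic.I Logic.I.
    by exists j; split=> //; apply: up Gx.
  by exists i; split=> //; apply: up Gy.
apply: (@gen_subalg_min _ _ _ [set b | _]); last first.
  move=> x [i [Gi Li] Six]; exists i => //; apply: sub_gen_subalg; exists i => //.
  by split=> //; apply: lexx.
split=> [||x y [i Li Gx] [j Lj Gy]|x y [i Li Gx] [j Lj Gy]|x [i Li Gx]].
- by exists i0 => //; case: (is_subalgebra_gen_steps (setI G (upto i0))).
- by exists i0 => //; case: (is_subalgebra_gen_steps (setI G (upto i0))).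
- have [k [Lk kx ky]] := max2 _ _ _ _ Li Lj Gx Gy; exists k => //.
  by case: (is_subalgebra_gen_steps (setI G (upto k))) => _ _ gI _ _; apply: gI.
- have [k [Lk kx ky]] := max2 _ _ _ _ Li Lj Gx Gy; exists k => //.
  by case: (is_subalgebra_gen_steps (setI G (upto k))) => _ _ _ gU _; apply: gU.
- exists i => //.
  by case: (is_subalgebra_gen_steps (setI G (upto i))) => _ _ _ _ gC; apply: gC.
Qed.

(** The limit step: [a] and [s] already occur at a common stage of [L]. When [L] is empty, [a] is
    its own separator. *)
Lemma separation_initial (G G' L : set I) :
  (forall i j, L i -> le j i -> L j) ->
  (forall i, L i -> separation (setI G (upto i)) (setI G' (upto i))
                      (setI (setI G G') (upto i))) ->
  separation (setI G L) (setI G' L) (setI (setI G G') L).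
Proof.
move=> Ldown sep a s Ga G's as0.
have [L0|Ln] := pselect (L !=set0); last first.
  exists a; split=> //; apply: gen_steps_mono Ga => j [_ Lj].
  by case: Ln; exists j.
have [_ _ letrans letot _] := wo_le.
have [i Li Gia] := gen_steps_upto L0 Ga; have [j Lj Gjs] := gen_steps_upto L0 G's.
have [k [Lk ik jk]] : exists k, [/\ L k, le i k & le j k].
  have [lexx _ _ _ _] := wo_le.
  have [ij|ji] := letot i j Logic.I Logic.I; [exists j|exists i]; split=> //; exact: lexx.
apply: (@separated_by_sub _ _ (gen_steps (setI (setI G G') (upto k)))).
  by apply: gen_steps_mono => l [Gl lk]; split=> //; apply: Ldown lk.
apply: (sep k Lk) => //.
  by apply: gen_steps_mono Gia => l [Gl li]; split=> //; apply: (letrans l i k).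
by apply: gen_steps_mono Gjs => l [Gl li]; split=> //; apply: (letrans l j k).
Qed.

(** Induction along [le] on the cuts of both sets at [i]: the earlier cuts combine to the part below
    [i], and then [i] is adjoined to both sets, to one of them or to neither. *)
Lemma D_closed_separation G G' : D_closed G -> D_closed G' ->
  separation G G' (setI G G').
Proof.
move=> clG clG'.
have setIU1 (X : set I) i : X i ->
    setI X (setU (below i) [set i]) = setU (setI X (below i)) [set i].
  move=> Xi; apply/seteqP; split=> [j [Xj [bj|->]]|j [[Xj bj]|->]].
  - by left.
  - by right.
  - by split=> //; left.
  - by split=> //; right.
have setIU1N (X : set I) i : ~ X i ->
    setI X (setU (below i) [set i]) = setI X (below i).
  move=> nXi; apply/seteqP; split=> [j [Xj [bj|ji]]|j [Xj bj]].
  - by [].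
  - by case: nXi; rewrite -ji.
  - by split=> //; left.
have key i : separation (setI G (upto i)) (setI G' (upto i))
               (setI (setI G G') (upto i)).
  elim/(well_founded_ind (init_seg_wf wo_le)): i => i IH.
  have {}IH : separation (setI G (below i)) (setI G' (below i))
                (setI (setI G G') (below i)).
    apply: separation_initial => [j k [_ [ji jni]] kj|j ji]; last exact: IH.
    have [_ leanti letrans _ _] := wo_le.
    split=> //; split; first exact: (letrans k j i).
    by move=> ki; apply: jni; apply: leanti => //; rewrite -ki.
  rewrite uptoE.
  have [Gi|nGi] := pselect (G i); have [G'i|nG'i] := pselect (G' i).
  - rewrite !setIU1 //; exact: separation_step_both.
  - rewrite (setIU1 _ _ Gi) (setIU1N _ _ nG'i) setIU1N; last by case.
    exact: separation_step_one.
  - rewrite (setIU1 _ _ G'i) (setIU1N _ _ nGi) setIU1N; last by case.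
    apply: separation_sym; rewrite [setI G G']setIC.
    apply: separation_step_one => //.
    by apply: separation_sym; rewrite [setI G' G]setIC.
  - by rewrite !setIU1N //; case.
have := @separation_initial G G' setT; rewrite !setIT; exact.
Qed.

(** Factors are replaced one at a time. [c j] is separated from the remaining meet, which lives over
    the closed union of [G] and the other [Gs k]; this union meets [Gs j] only inside [G]. The
    separator is absorbed into [e], which is why [e] appears in the statement. *)
Lemma separation_finite (J : eqType) (s : seq J) (Gs : J -> set I) (G : set I)
    (c : J -> B) (e : B) :
  uniq s -> D_closed G -> (forall j, D_closed (Gs j)) ->
  (forall j k, j != k -> (setI (Gs j) (Gs k) `<=` G)%classic) ->
  (forall j, gen_steps (Gs j) (c j)) -> gen_steps G e ->
  e `&` \meet_(j <- s) c j = \bot ->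
  exists d : J -> B, (forall j, j \in s -> gen_steps G (d j) /\ c j <= d j) /\
    e `&` \meet_(j <- s) d j = \bot.
Proof.
move=> us clG clGs sepG cG; elim: s us e => [_ e eG|j s IHs].
  by rewrite !big_nil => e0; exists c; split=> //; rewrite big_nil.
move=> /= /andP[js us] e eG; rewrite big_cons => ecs.
pose U : set I := setU G (\bigcup_(k in [set k | k \in s]) Gs k).
have clU : D_closed U.
  move=> i [/clG h l /h|[k ks ki] l il]; first by left.
  by right; exists k => //; apply: clGs ki l il.
have [_ U1 UI _ _] := is_subalgebra_gen_steps U.
have Ue : gen_steps U (e `&` \meet_(k <- s) c k).
  apply: (UI _ _ _ _); first by apply: gen_steps_mono eG => i; left.
  rewrite big_seq; apply: (big_ind (gen_steps U) U1 UI) => k ks.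
  by apply: gen_steps_mono (cG k) => i ki; right; exists k.
have [|b [Fb cb be]] := D_closed_separation (clGs j) clU (cG j) Ue.
  by rewrite meetCA.
have Gb : gen_steps G b.
  apply: gen_steps_mono Fb => i [ji [//|[k ks ki]]].
  apply: (sepG j k) => //; apply/eqP => jk; by move: js; rewrite jk ks.
have [_ _ GI _ _] := is_subalgebra_gen_steps G.
have [|d [dP ed]] := IHs us (e `&` b) (GI _ _ eG Gb).
  by rewrite -meetA meetCA.
exists (fun k => if k == j then b else d k); split.
  by move=> k; rewrite inE; case: eqP => [-> _|_ /= /dP].
rewrite big_cons eqxx meetA -[RHS]ed; congr (_ `&` _).
rewrite big_seq [RHS]big_seq; apply: eq_bigr => k ks.
by case: eqP => // kj; move: js; rewrite -kj ks.
Qed.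

End Skeleton.

(** * From tight filtrations to skeletons *)

Lemma tightly_sigma_filtered_skeleton (disp : Order.disp_t)
    (B : ctbDistrLatticeType disp) :
  tightly_sigma_filtered B ->
  exists (I : Type) (le : I -> I -> Prop) (S : I -> set B) (D : I -> set I),
    skeleton le S D.
Proof.
move=> [I [le [Bs /= [wo [[sBs mBs] [B0 cover lim succ]]]]]].
have [lexx leanti letrans letot lemin] := wo.
have hasucc a b : le a b /\ a <> b ->
    exists c, [/\ le a c /\ a <> c, le c b & forall k, le a k /\ a <> k -> le c k].
  move=> ab; have [//||c ac cmin] := lemin [set c | le a c /\ a <> c]; first by exists b.
  by exists c; split=> //; apply: cmin.
have /choice[RS RSP] : forall a, exists RS : set B * set B,
    [/\ countable RS.1 /\ countable RS.2, is_subalgebra RS.2,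
      (RS.1 `<=` Bs a)%classic,
      (forall b, le a b /\ a <> b -> (forall k, le a k /\ a <> k -> le b k) ->
         Bs b = gen_subalg (setU (Bs a) RS.2)) &
      (forall t x, RS.2 t -> Bs a x -> t `&` x = \bot -> separated_by RS.1 t x)].
  move=> a; have [[b0 ab0]|amax] := pselect (exists b, le a b /\ a <> b).
    have [b [ab _ bmin]] := hasucc _ _ ab0.
    have [R [S [cR cS [[sR _ sS _] [[RA _ _ _] [genE RE comm]]]]]] := succ a b ab bmin.
    exists (R, S); split=> //=.
      move=> c ac cmin; rewrite genE; congr Bs.
      by apply: leanti => //; [apply: cmin|apply: bmin].
    move=> t x St Bx tx; have [|b1 [b2 [_ Rb2 xb1 tb2 b12]]] := comm x t Bx St.
      by rewrite meetC.
    exists b2; split=> //; first by rewrite -RE.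
    by apply/eqP; rewrite -lex0 -b12 [b1 `&` _]meetC; apply: leI2.
  (* A last index has no push-out attached. The trivial algebra serves there as both R and S, and
     each of its elements is its own separator. *)
  have c0 : countable (gen_subalg (@set0 B)) by apply: countable_gen_subalg.
  exists (gen_subalg set0, gen_subalg set0); split=> //=.
  - exact: is_subalgebra_gen.
  - exact: gen_subalg_min.
  - by move=> b ab; case: amax; exists b.
  - by move=> t x Gt _ tx; exists t.
pose S a := (RS a).2.
(* Each stage is generated by the pieces strictly before it: the first is trivial, limits are
   unions, and a successor adds one piece. *)
have BsE a : Bs a = gen_steps S (init_seg setT le a).
  apply/seteqP; split; last first.
    apply: gen_subalg_min => // x [c [_ ca] Sx].
    have [c' [cc' c'a c'min]] := hasucc _ _ ca.
    apply: (mBs _ _ c'a); have [_ _ _ sE _] := RSP c; rewrite (sE c') //.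
    by apply: sub_gen_subalg; right.
  elim/(well_founded_ind (init_seg_wf wo)): a => a IH.
  have up c : init_seg setT le a c ->
      (gen_steps S (init_seg setT le c) `<=` gen_steps S (init_seg setT le a))%classic.
    move=> [_ [ca cna]]; apply: gen_steps_mono => k [_ [kc knc]].
    split=> //; split; first exact: (letrans k c a).
    by move=> ka; apply: cna; apply: leanti => //; rewrite -ka.
  have [[j0 j0a]|amin] := pselect (exists j, le j a /\ j <> a); last first.
    rewrite B0; last first.
      move=> j; have [//|ja] := letot a j Logic.I Logic.I.
      have [->|nja] := pselect (j = a); first exact: lexx.
      by case: amin; exists j.
    by have [g0 g1 _ _ _] := is_subalgebra_gen_steps S (init_seg setT le a) => x [->|->].
  have [islim|/existsNP[j /not_implyP[ja nk]]] :=
    pselect (forall j, le j a /\ j <> a -> exists k, (le j k /\ j <> k) /\ (le k a /\ k <> a)).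
    rewrite (lim a) //; last by exists j0.
    by move=> x [j ja Bx]; apply: (up j) => //; apply: IH.
  have [_ _ _ sE _] := RSP j; rewrite (sE a) //; last first.
    move=> k jk; have [//|ka] := letot a k Logic.I Logic.I.
    have [->|nka] := pselect (k = a); first exact: lexx.
    by case: nk; exists k.
  apply: gen_subalg_min; first exact: is_subalgebra_gen.
  move=> x [Bx|Sx]; first by apply: (up j) => //; apply: IH.
  by apply: sub_gen_subalg; exists j.
(* R_a is countable and each of its elements has a countable support below [a]; [D a] is the union
   of these supports. *)
have /choice[D DP] : forall a, exists D : set I,
    [/\ countable D, (D `<=` init_seg setT le a)%classic &
        ((RS a).1 `<=` gen_steps S D)%classic].
  move=> a; have [[cR _] _ RB _ _] := RSP a.
  have /choice[g gP] : forall r, exists g : set I, (RS a).1 r ->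
      [/\ (g `<=` init_seg setT le a)%classic, countable g & gen_steps S g r].
    move=> r; have [Rr|] := pselect ((RS a).1 r); last by exists set0.
    have := RB _ Rr; rewrite BsE => /gen_steps_countable_support[g gP]; by exists g.
  exists (\bigcup_(r in (RS a).1) g r); split.
  - by apply: bigcup_countable => // r /gP[].
  - by move=> i [r /gP[sub _ _] /sub].
  - move=> r Rr; have [_ _ gr] := gP r Rr.
    by apply: gen_steps_mono gr => i gi; exists r.
exists I, le, S, D; split=> //.
- by move=> i; have [[]] := RSP i.
- by move=> i; have [] := DP i.
- move=> i t x St; rewrite -BsE => Bx tx.
  have [_ _ _ _ sep] := RSP i; have [_ _ RD] := DP i.
  exact: separated_by_sub RD (sep t x St Bx tx).
- move=> b; have [i] := cover b; rewrite BsE.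
  by move=> /gen_steps_countable_support[G [_ cG Gb]]; exists G.
Qed.

(** * Boolean polynomials *)

Section BooleanPolynomials.
Context {disp : Order.disp_t} {B : ctbDistrLatticeType disp} {n : nat}.
Implicit Types (P : bpoly n) (a : 'I_n -> B) (ep : {ffun 'I_n -> bool}).

Definition literal (e : bool) (x : B) : B := if e then x else ~` x.
(** A point of the cube with coordinates 0 and 1; the value of [P] there is the coefficient of the
    minterm [ep] in its disjunctive normal form. *)
Definition vertex ep : 'I_n -> B := fun i => if ep i then \top else \bot.

Lemma bpoly_eval_subalg (A : set B) P a :
  is_subalgebra A -> (forall i, A (a i)) -> A (bpoly_eval P a).
Proof.
move=> [A0 A1 AI AU AC] Aa.
by elim: P => [i|||p IHp q IHq|p IHp q IHq|p IHp] //=; [apply: AI|apply: AU|apply: AC].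
Qed.

(** Relative to [m], every Boolean operation depends only on the traces of its arguments on [m]; for
    complements this is [complE]. *)
Lemma bpoly_eval_meet (m : B) P a a' :
  (forall i, m `&` a i = m `&` a' i) ->
  m `&` bpoly_eval P a = m `&` bpoly_eval P a'.
Proof.
move=> aa'; elim: P => [i|||p IHp q IHq|p IHp q IHq|p IHp] //=.
- by rewrite -[m]meetxx !(meetACA m m) IHp IHq.
- by rewrite !meetUr IHp IHq.
have complE (x : B) : m `&` ~` x = m `&` ~` (m `&` x).
  by rewrite complI meetUr meetxC join0x.
by rewrite complE IHp -complE.
Qed.

Lemma bpoly_eval_minterm P a ep (m := \meet_i literal (ep i) (a i)) :
  m `&` bpoly_eval P a = m `&` bpoly_eval P (vertex ep).
Proof.
apply: bpoly_eval_meet => i.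
have : m <= literal (ep i) (a i) by apply: meets_inf.
rewrite /vertex /literal; case: (ep i) => [ma|]; first by rewrite meetx1; apply/meet_idPl.
by rewrite -disj_leC meetx0 => /eqP.
Qed.

(** The list [s] is arbitrary for the induction, each step of which splits [x] along [a i] and its
    complement. *)
Lemma minterms_cover (x : B) (s : seq 'I_n) a : uniq s ->
  (forall ep, x `&` \meet_(i <- s) literal (ep i) (a i) = \bot) -> x = \bot.
Proof.
elim: s => [_ /(_ [ffun=> true])|i s IHs /= /andP[nis us] x0].
  by rewrite big_nil meetx1.
apply: IHs => // ep.
have xe e : literal e (a i) `&` (x `&` \meet_(k <- s) literal (ep k) (a k)) = \bot.
  have := x0 [ffun k => if k == i then e else ep k].
  rewrite big_cons ffunE eqxx meetCA => <-; congr (_ `&` (_ `&` _)).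
  rewrite big_seq [RHS]big_seq; apply: eq_bigr => k ks; rewrite ffunE.
  by case: eqP => // ki; move: nis; rewrite -ki ks.
move: (x `&` _) xe => y xe.
apply/eqP; rewrite -[X in X == _]meet1x -(joinxC (a i)) meetUl join_eq0.
by apply/andP; split; apply/eqP; [exact: (xe true)|exact: (xe false)].
Qed.

(** Turns the vanishing of [P] into disjointness conditions, one per minterm, of the form treated by
    [separation_finite]. *)
Lemma bpoly_eval_eq0P P a :
  (forall ep, bpoly_eval P (vertex ep) `&` \meet_i literal (ep i) (a i) = \bot) <->
  bpoly_eval P a = \bot.
Proof.
split=> [P0|P0 ep]; last by rewrite meetC -bpoly_eval_minterm P0 meetx0.
apply: (minterms_cover (index_enum_uniq 'I_n) (a := a)) => ep.
by rewrite meetC bpoly_eval_minterm meetC.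
Qed.

End BooleanPolynomials.

(** * The dichotomy for omega_2 many countable sets *)

Theorem theorem4p4 (disp : Order.disp_t) (B : ctbDistrLatticeType disp)
    (HB : tightly_sigma_filtered B)
    (calH : set (set B))
    (Hcount : forall H, calH H -> countable H)
    (Hcard : card_eq_omega2 calH)
    (n : nat) (P : bpoly n) :
  (exists2 calH0 : set (set B), calH0 `<=` calH /\ card_eq_omega2 calH0 &
     forall (H : 'I_n -> set B) (a : 'I_n -> B),
       (forall i, calH0 (H i)) -> injective H -> (forall i, H i (a i)) ->
       bpoly_eval P a <> \bot)
  \/
  (exists calHs : 'I_n -> set (set B),
     (forall i, calHs i `<=` calH /\ card_eq_omega2 (calHs i)) /\
     forall H : 'I_n -> set B, (forall i, calHs i (H i)) ->
       exists a : 'I_n -> B, (forall i, H i (a i)) /\ bpoly_eval P a = \bot).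
Proof.
have [I [le [S [D skel]]]] := tightly_sigma_filtered_skeleton HB.
have /choice[G GP] : forall H : set B, exists G : set I, countable H ->
    [/\ countable G, D_closed D G & (H `<=` gen_steps S G)%classic].
  move=> H; have [cH|] := pselect (countable H); last by exists set0.
  have [_ _ _ _ cover] := skel.
  have /choice[g gP] : forall b, exists g, countable g /\ gen_steps S g b.
    by move=> b; have [g] := cover b; exists g.
  have [|G [sG cG clG]] := D_closed_hull skel (G := \bigcup_(b in H) g b).
    by apply: bigcup_countable => // b _; have [] := gP b.
  exists G; split=> // b Hb; have [_] := gP b.
  by apply: gen_steps_mono => i gi; apply: sG; exists b.
have [|K [Gam0 [KH K2 cGam0 sep0]]] := omega2_root_countable (G := G) Hcard.
  by move=> H /Hcount/GP[].
(* Enlarging the root to a closed set keeps the pairwise intersections inside it and makes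
   [separation_finite] applicable. *)
have [Gam [Gam0S cGam clGam]] := D_closed_hull skel cGam0.
have sE := is_subalgebra_gen_steps S Gam.
have [||e [f [eE fK]]] := @countable_enumeration _ (gen_steps S Gam).
- exact: countable_gen_steps skel _ cGam.
- by exists \bot; case: sE.
(* A code [w] names, for each sign vector [ep], upper bounds in [gen_steps S Gam] for the
   literals of the minterm [ep]. *)
pose code := {ffun {ffun 'I_n -> bool} * 'I_n -> nat}.
pose good (w : code) := forall ep : {ffun 'I_n -> bool},
  bpoly_eval P (vertex ep) `&` \meet_i e (w (ep, i)) = \bot.
pose bounded (w : code) i (a : B) :=
  forall ep : {ffun 'I_n -> bool}, literal (ep i) a <= e (w (ep, i)).
pose Kb (w : code) i : set (set B) := [set H | K H /\ exists2 a, H a & bounded w i a].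
have [[w [gw big]]|nbig] :=
  pselect (exists w, good w /\ forall i, ~ card_le_omega1 (Kb w i)); [right|left].
  exists (Kb w); split=> [i|H HK].
    have KbK : (Kb w i `<=` K)%classic by move=> H [].
    by split; [move=> H /KbK/KH|exact: card_eq_omega2_sub KbK K2 (big i)].
  have /choice[a aP] : forall i, exists a, H i a /\ bounded w i a.
    by move=> i; have [_ [a Ha ba]] := HK i; exists a.
  exists a; split=> [i|]; first by have [] := aP i.
  (* The bounds in [w] do not depend on the choice of the [H i], so each minterm lies below a
     product that [good w] makes zero. *)
  apply/bpoly_eval_eq0P => ep; apply/eqP; rewrite -lex0 -(gw ep).
  apply: leI2 => //; apply/meetsP => i _.
  by apply: (le_trans _ ((aP i).2 ep)); apply: meets_inf.
(* There are only countably many codes, so removing every small [Kb] of a good code removes at most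
   omega_1 sets. *)
pose small : set (code * 'I_n) := [set p | good p.1 /\ card_le_omega1 (Kb p.1 p.2)].
pose bad : set (set B) := \bigcup_(p in small) Kb p.1 p.2.
have obad : card_le_omega1 bad.
  apply: card_le_omega1_bigcup => [|p []//].
  exact/countable_card_le_omega1/countableP.
have K'2 : card_eq_omega2 (setD K bad).
  apply: (card_eq_omega2_sub _ K2) => [H []//|oK']; apply: K2.2.
  apply: card_le_omega1_sub (card_le_omega1U oK' obad) => H KH'.
  by have [?|?] := pselect (bad H); [right|left].
exists (setD K bad); first by split=> // H [/KH].
move=> H a HK Hinj Ha P0.
have KHi i : K (H i) by have [] := HK i.
have GPi i := GP _ (Hcount _ (KH _ (KHi i))).
have /choice[d dP] : forall ep : {ffun 'I_n -> bool}, exists d : 'I_n -> B,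
    (forall i, gen_steps S Gam (d i) /\ literal (ep i) (a i) <= d i) /\
    bpoly_eval P (vertex ep) `&` \meet_i d i = \bot.
  move=> ep.
  have [|||||d [dP d0]] := separation_finite skel (Gs := fun i => G (H i))
    (c := fun i => literal (ep i) (a i)) (e := bpoly_eval P (vertex ep))
    (index_enum_uniq 'I_n) clGam.
  - by move=> i; have [] := GPi i.
  - move=> i j ij; apply: subset_trans Gam0S; apply: sep0 => // Hij.
    by move/eqP: ij; apply; apply: Hinj.
  - move=> i; have [_ _ sub] := GPi i.
    have [_ _ _ _ gC] := is_subalgebra_gen_steps S (G (H i)).
    by rewrite /literal; case: (ep i); [|apply: gC]; apply: sub.
  - apply: bpoly_eval_subalg => // i; rewrite /vertex.
    by case: sE => g0 g1 _ _ _; case: (ep i).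
  - exact: (bpoly_eval_eq0P P a).2 P0 ep.
  by exists d; split=> // i; apply: dP; rewrite mem_index_enum.
pose w : code := [ffun p => f (d p.1 p.2)].
have ew ep i : e (w (ep, i)) = d ep i.
  by rewrite ffunE /= fK //; have [/(_ i)[]] := dP ep.
have gw : good w.
  by move=> ep; under eq_bigr do rewrite ew; have [] := dP ep.
(* The zero of [P] has produced a good code [w], so some [Kb w i] is small. It contains [H i],
   witnessed by [a i], although [H i] survived the deletion. *)
have [i oKb] : exists i, card_le_omega1 (Kb w i).
  apply: contrapT => nex; apply: nbig; exists w; split=> // i oKb.
  by apply: nex; exists i.
have [_ nbad] := HK i; apply: nbad; exists (w, i) => //; split=> //.
by exists (a i) => // ep; rewrite ew; have [/(_ i)[]] := dP ep.
Qed.
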